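(* Let $S = \langle n_1, \ldots, n_d\rangle$ be a numerical semigroup with minimal generators $n_1,\ldots,n_d$, let $m \in S$, and let $F \subseteq [d]$. Let $b = m - n_F$, let $p \in \mathbb{Z}_{\ge 0}$ with $\gcd(p,b)=1$, and let $T = pS + b\langle 1\rangle$. If $b \in S\setminus\{0\}$ and $\Delta^S_{n_F} = 2^F$, then the squarefree divisor complex $\Delta^T_{pm}$ is the complex $\Delta^S_m$ with one new vertex $b$, and the only facet containing $b$ is $F\cup\{b\}$.
   Context: A numerical semigroup is a subset $S \subseteq \mathbb{Z}_{\ge 0}$ with finite complement that is closed under addition and contains $0$. For integers $t_1,\dots,t_r\ge 0$, $\langle t_1,\ldots,t_r\rangle = \{\alpha_1t_1+\cdots+\alpha_rt_r : \alpha_i\in\mathbb{Z}_{\ge 0}\}$; in particular $\langle 1\rangle=\mathbb{Z}_{\ge 0}$. Every numerical semigroup has a unique minimal generating set, consisting of its irreducible elements (the positive elements that are not sums of strictly smaller elements of the semigroup); when we write $S=\langle n_1,\ldots,n_d\rangle$ for a numerical semigroup, the $n_i$ are assumed to be precisely these. Write $[d]=\{1,\ldots,d\}$, and for $G\subseteq[d]$ write $n_G=\sum_{i\in G}n_i$. For $m\in S$, the squarefree divisor complex of $m$ in $S$ is the simplicial complex $\Delta^S_m=\{G\subseteq[d] : m-n_G\in S\}$. Here $pS+b\langle 1\rangle=\{ps+bc : s\in S,\ c\in\mathbb{Z}_{\ge 0}\}=\langle pn_1,\ldots,pn_d,b\rangle$. The complex $\Delta^T_{pm}$ is the squarefree divisor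 complex of $pm$ in $T$, where the vertex $i\in[d]$ refers to the generator $pn_i$ and the vertex named $b$ refers to the generator $b$. Facets are maximal faces, and $2^F$ denotes the set of all subsets of $F$.
   Formalization: The formal theorem assumes p > 0 instead of p ≥ 0: for p = 0 the claim is false, since gcd(0,b)=1 forces b = 1, T is all of Z_{≥0}, pm = 0, and {b} is not a face (e.g. S = ⟨1⟩, F = ∅, m = b = 1). *)

(* Defs.v *)
From HB Require Import structures.
From mathcomp Require Import all_boot all_order all_algebra.
From mathcomp Require Import boolp classical_sets cardinality.

Set Implicit Arguments.
Unset Strict Implicit.
Unset Printing Implicit Defensive.

Import GRing.Theory Num.Theory.

Local Open Scope classical_set_scope.
Local Open Scope nat_scope.

Definition numerical_semigroup (S : set nat) : Prop :=
  [/\ S 0, forall x y : nat, S x -> S y -> S (x + y) & finite_set (~` S)].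

Definition generated (V : finType) (g : V -> nat) : set nat :=
  [set x | exists a : V -> nat, x = \sum_(v : V) a v * g v].

Definition irreducible_in (S : set nat) (x : nat) : Prop :=
  [/\ S x, 0 < x &
      ~ exists s : seq nat,
          (forall y : nat, y \in s -> S y /\ y < x) /\ x = \sum_(y <- s) y].

Definition minimal_generators (S : set nat) (d : nat) (n : 'I_d -> nat) : Prop :=
  [/\ S = generated n, injective n & range n = [set x | irreducible_in S x]].

Definition gsum (V : finType) (g : V -> nat) (G : {set V}) : nat :=
  \sum_(v in G) g v.

(* The vertices are the indices of the family g, not its values, so g may take
   the same value twice.  The difference m - g_G is taken in the integers:
   truncated subtraction would create faces with g_G > m. *)
Definition sqfree_divisor_complex (S : set nat) (V : finType) (g : V -> nat)
    (m : nat) : set {set V} :=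
  [set G : {set V} | exists2 s : nat, S s & (s%:Z = m%:Z - (gsum g G)%:Z)%R].

Definition facet (V : finType) (D : set {set V}) (H : {set V}) : Prop :=
  D H /\ forall K : {set V}, D K -> H \subset K -> K = H.

(* pS + b<1> *)
Definition scale_adjoin (p : nat) (S : set nat) (b : nat) : set nat :=
  [set x | exists s c : nat, S s /\ x = p * s + b * c].

(* The vertex [Some i] carries p n_i; [None] is the vertex named b. *)
Definition scale_adjoin_gens (d : nat) (p : nat) (n : 'I_d -> nat) (b : nat)
    (v : option 'I_d) : nat :=
  if v is Some i then p * n i else b.

(* E is the complex D, its vertex i being renamed [Some i], with one new vertex
   [None]: deleting [None] from E gives D. *)
Definition one_new_vertex (V : finType) (D : set {set V})
    (E : set {set option V}) : Prop :=
  E [set None]%SET /\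
  forall H : {set option V},
    (E H /\ None \notin H) <-> (exists2 G : {set V}, D G & H = Some @: G).

(* Main.v *)
Require Import Defs.
From mathcomp Require Import all_boot all_order all_algebra.
From mathcomp Require Import boolp classical_sets cardinality.
From mathcomp Require Import zify.

(** Everything rests on one observation: if [p * z = p * s + b * c] with [p]
    prime to [b], then [p] divides [c], so [c = p * k] and [z = s + b * k]
    ([scale_adjoin_mulE]).

    For a set of vertices [Some @: G], avoiding the new vertex, this makes
    [p * (m - n_G)] a member of [T] exactly when [m - n_G] belongs to [S], as
    [b] itself lies in [S].  Hence deleting the new vertex leaves the complex
    of [m] ([face_old]).

    For [None |: Some @: G], suppose that [p * (m - n_G) - b = p * s + b * c].
    Then [p * (m - n_G) = p * s + b * c.+1], and since [c.+1] is a positive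
    multiple [p * k] of [p], one whole copy of [b] can be removed:
    [m - n_G - b = s + b * k.-1] lies in [S].  But [m - b = n_F], so this says
    that [G] is a face of the complex of [n_F], that is, [G \subset F].
    Conversely [n_F - n_G = s] with [s] in [S] gives
    [p * (m - n_G) - b = p * s + b * p.-1] in [T] ([face_new]).  The faces
    through the new vertex thus form the full simplex on [None |: Some @: F],
    which is therefore the only facet among them. *)

Lemma sqfree_divisor_complexP {S : set nat} {V : finType} {g : V -> nat}
    {m : nat} {G : {set V}} :
  sqfree_divisor_complex S g m G <-> exists2 s, S s & (s + gsum g G = m)%N.
Proof. by split=> -[s Ss e]; exists s => //; lia. Qed.

Lemma set_option_split {V : finType} (H : {set option V}) :
  let G := Some @^-1: H in
  H = (if None \in H then None |: Some @: G else Some @: G)%SET.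
Proof.
move=> G; apply/setP=> -[v|].
  by case: ifP => _; rewrite ?in_setU1 /= mem_imset ?inE //; apply: Some_inj.
case: ifP => _; first by rewrite !inE.
by apply/esym/negbTE/imsetP => -[].
Qed.

Lemma None_notin_Some {V : finType} (G : {set V}) : None \notin (Some @: G)%SET.
Proof. by apply/imsetP=> -[]. Qed.

Lemma gsum_Some (d p : nat) (n : 'I_d -> nat) (b : nat) (G : {set 'I_d}) :
  gsum (scale_adjoin_gens p n b) (Some @: G)%SET = (p * gsum n G)%N.
Proof. by rewrite /gsum big_imset ?big_distrr //= => i j _ _ []. Qed.

Lemma gsum_None_Some (d p : nat) (n : 'I_d -> nat) (b : nat)
    (G : {set 'I_d}) :
  gsum (scale_adjoin_gens p n b) (None |: Some @: G)%SET
  = (b + p * gsum n G)%N.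
Proof. by rewrite /gsum big_setU1 ?None_notin_Some //= -(gsum_Some _ _ _ b). Qed.

Lemma scale_adjoin_mulE {p b z s c : nat} :
  (0 < p)%N -> coprime p b -> (p * z = p * s + b * c)%N ->
  exists2 k, (c = p * k)%N & (z = s + b * k)%N.
Proof.
move=> p0 pb e.
have /dvdnP[k ck]: (p %| c)%N.
  rewrite -(Gauss_dvdr c pb) -(dvdn_addr _ (dvdn_mulr s (dvdnn p))) -e.
  exact: dvdn_mulr.
exists k; first by rewrite ck mulnC.
by apply/eqP; rewrite -(eqn_pmul2l p0) e ck; apply/eqP; lia.
Qed.

Lemma add_multiple_closed (S : set nat) (b s k : nat) :
  (forall x y, S x -> S y -> S (x + y)%N) -> S b -> S s -> S (s + b * k)%N.
Proof.
move=> SD Sb Ss; elim: k => [|k IH]; first by rewrite muln0 addn0.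
by rewrite mulnSr addnA; apply: SD.
Qed.

Section Faces.

Variables (S : set nat) (d : nat) (n : 'I_d -> nat) (p b : nat).
Hypothesis SD : forall x y, S x -> S y -> S (x + y)%N.
Hypotheses (Sb : S b) (p0 : (0 < p)%N) (pb : coprime p b).

Let DT m := sqfree_divisor_complex (scale_adjoin p S b)
  (scale_adjoin_gens p n b) (p * m)%N.

Lemma face_old (m : nat) (G : {set 'I_d}) :
  DT m (Some @: G)%SET <-> sqfree_divisor_complex S n m G.
Proof.
split=> /sqfree_divisor_complexP[x].
  move=> [s [c [Ss ->]]]; rewrite gsum_Some => e.
  have e' : (p * m = p * (s + gsum n G) + b * c)%N by lia.
  have [k _ ->] := scale_adjoin_mulE p0 pb e'.
  apply/sqfree_divisor_complexP; exists (s + b * k)%N; last by lia.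
  exact: add_multiple_closed.
move=> Sx <-; apply/sqfree_divisor_complexP; exists (p * x)%N.
  by exists x, 0%N; rewrite muln0 addn0.
by rewrite gsum_Some mulnDr.
Qed.

(** The new vertex uses up one copy of [b], so [G] must be a face of the
    complex of [m - b]; here [q] is that difference. *)
Lemma face_new (q : nat) (G : {set 'I_d}) :
  DT (b + q)%N (None |: Some @: G)%SET <-> sqfree_divisor_complex S n q G.
Proof.
split=> /sqfree_divisor_complexP[x].
  move=> [s [c [Ss ->]]]; rewrite gsum_None_Some => e.
  have e' : (p * (b + q) = p * (s + gsum n G) + b * c.+1)%N by lia.
  have [[|k]] := scale_adjoin_mulE p0 pb e'; first by rewrite muln0.
  move=> _ ek; apply/sqfree_divisor_complexP; exists (s + b * k)%N; last by lia.
  exact: add_multiple_closed.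
move=> Sx <-; apply/sqfree_divisor_complexP.
exists (p * x + b * p.-1)%N; first by exists x, p.-1.
by rewrite gsum_None_Some; case: p p0 => // r _ /=; lia.
Qed.

End Faces.

Theorem theorem2p6 (S : set nat) (d : nat) (n : 'I_d -> nat) (m : nat)
    (F : {set 'I_d}) (b p : nat) (T : set nat)
    (hS : numerical_semigroup S)
    (hn : minimal_generators S n)
    (hm : S m)
    (hb : (b%:Z = m%:Z - (gsum n F)%:Z)%R)
    (hp : (0 < p)%N)
    (hpb : coprime p b)
    (hT : T = scale_adjoin p S b)
    (hbS : S b) (hb0 : b <> 0%N)
    (hF : sqfree_divisor_complex S n (gsum n F)
          = [set G : {set 'I_d} | G \subset F]%classic) :
  let DT := sqfree_divisor_complex T (scale_adjoin_gens p n b) (p * m)%N in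
  one_new_vertex (sqfree_divisor_complex S n m) DT /\
  forall H : {set option 'I_d},
    (facet DT H /\ None \in H) <-> H = (None |: Some @: F)%SET.
Proof.
move=> DT; have [_ SD _] := hS.
have old (G : {set 'I_d}) : DT (Some @: G)%SET <-> sqfree_divisor_complex S n m G.
  by rewrite /DT hT; apply: face_old.
have new (G : {set 'I_d}) : DT (None |: Some @: G)%SET <-> G \subset F.
  have em : m = (b + gsum n F)%N by lia.
  by rewrite /DT hT em face_new // hF.
have newT : DT (None |: Some @: F)%SET by apply/new.
have max (K : {set option 'I_d}) : DT K -> None \in K -> K \subset (None |: Some @: F)%SET.
  move=> DK NK; move: DK; rewrite (set_option_split K) NK => /new GF.
  by apply/finset.setUS/imsetS.
split; first split.
- by have /new := finset.sub0set F; rewrite imset0 finset.setU0.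
- move=> H; split=> [[DH NH]|[G DG ->]].
    have := set_option_split H; rewrite (negbTE NH) => eH.
    by exists (Some @^-1: H)%SET => //; apply/old; rewrite -eH.
  by split; [apply/old | apply: None_notin_Some].
move=> H; split=> [[[DH maxH] NH]|->].
  by apply/esym/maxH => //; apply: max.
split; last by rewrite !inE.
split=> // K DK sK; apply/eqP; rewrite finset.eqEsubset sK andbT.
by apply: max => //; apply: (fintype.subsetP sK); rewrite !inE.
Qed.
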